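(* Let $\alpha\in(0,1)$. If every job is $\alpha$-loose, i.e. $p_j\le \alpha(d_j-r_j)$ for all jobs $j$, then EDF is a $1/(1-\alpha)^2$-competitive algorithm for preemptive semi-online machine minimization; that is, EDF run on $m/(1-\alpha)^2$ machines produces a feasible schedule, where $m$ is the optimal number of machines.
   Context: Machine minimization with deadlines: each job $j$ of a finite instance has integer release date $r_j$, processing time $p_j$ and deadline $d_j$. A feasible preemptive schedule on a given number of identical machines processes each job for $p_j$ units within $[r_j,d_j]$, each machine processing at most one job at a time, no job running on two machines at once, and jobs may be preempted and resumed on any machine. $m$ denotes the minimum number of machines admitting a feasible schedule. In the semi-online problem jobs become known at their release dates and $m$ is known in advance. An algorithm is $c$-competitive if it always produces a feasible schedule with at most $c\cdot m$ machines (the number $cm$ of machines is treated as an integer). The Earliest Deadline First algorithm (EDF) on $k$ machines makes decisions at integer times and at each time processes the $k$ released, unfinished jobs with the smallest deadlines, ties broken in favor of earlier release date and then smaller job index. *)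

(* Defs.v *)
From HB Require Import structures.
From mathcomp Require Import all_boot all_order all_algebra.
From mathcomp Require Import all_classical all_reals all_analysis.

Set Implicit Arguments.
Unset Strict Implicit.
Unset Printing Implicit Defensive.

Import Order.TTheory GRing.Theory Num.Theory.
Local Open Scope classical_set_scope.
Local Open Scope ring_scope.

Record instance := Instance {
  njobs : nat;
  release : 'I_njobs -> int;
  proc : 'I_njobs -> nat;
  deadline : 'I_njobs -> int }.

Definition job (I : instance) := 'I_(njobs I).

(* [s t i = Some j]: machine [i] processes job [j] at time [t];
   [s t i = None]: machine [i] is idle at time [t].  Time is continuous, and
   that a machine processes at most one job at a time is built into the type. *)
Definition schedule (R : realType) (I : instance) (k : nat) :=
  R -> 'I_k -> option (job I).

Definition processing_times (R : realType) (I : instance) (k : nat)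
    (s : schedule R I k) (i : 'I_k) (j : job I) : set R :=
  [set t | s t i = Some j].

(* A job may be preempted at arbitrary real times; the amount of processing it
   receives is the total Lebesgue measure of the times at which it runs. *)
Definition feasible (R : realType) (I : instance) (k : nat)
    (s : schedule R I k) : Prop :=
  [/\ forall i j, measurable (processing_times s i j),
      forall t i i' j, s t i = Some j -> s t i' = Some j -> i = i',
      forall t i j, s t i = Some j ->
        (release j)%:~R <= t <= (deadline j)%:~R
    & forall j, (\sum_(i < k) lebesgue_measure (processing_times s i j)
                 = (proc j)%:R%:E)%E].

Definition min_machines (R : realType) (I : instance) (m : nat) : Prop :=
  (exists s : schedule R I m, feasible s) /\
  forall (k : nat) (s : schedule R I k), feasible s -> (m <= k)%N.

Definition loose (R : realType) (a : R) (I : instance) : Prop :=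
  forall j : job I, (proc j)%:R <= a * (deadline j - release j)%:~R.

Section EDF.
Context (I : instance) (k : nat).

(* [j] precedes [j']: earlier deadline, then earlier release date, then smaller
   index. *)
Definition edf_le (j j' : job I) : bool :=
  (deadline j < deadline j') ||
  (deadline j == deadline j') &&
    ((release j < release j') ||
     (release j == release j') && (j <= j')%N).

(* The jobs run during [t, t + 1), in order of priority, when [rem j] units of
   each job [j] are left at time [t]. *)
Definition edf_select (rem : job I -> nat) (t : int) : seq (job I) :=
  take k (sort edf_le [seq j <- enum 'I_(njobs I) |
                         (release j <= t) && (0 < rem j)%N]).

(* A time at or before every release date, so that no job runs before it. *)
Definition edf_origin : int := \big[Num.min/0]_(j < njobs I) release j.

Fixpoint edf_remaining (n : nat) : job I -> nat :=
  if n is n'.+1 then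
    let rem := edf_remaining n' in
    fun j => (rem j - (j \in edf_select rem (edf_origin + n'%:Z)%R))%N
  else @proc I.

(* For [t < edf_origin] the argument of [edf_remaining] is meaningless, but then
   no job is released by [t] and the selection is empty. *)
Definition edf_jobs (t : int) : seq (job I) :=
  edf_select (edf_remaining `|t - edf_origin|%N) t.

End EDF.

(* An unfinished job stays eligible after its deadline, so that a missed deadline
   shows up as an infeasible schedule. *)
Definition edf (R : realType) (k : nat) (I : instance) : schedule R I k :=
  fun t i => onth (edf_jobs I k (Num.floor t)) i.

(* An algorithm [A], given a number of machines and an instance, returns a
   schedule; in the semi-online model that number may depend on the optimum [m].
   The number [c * m] of machines is rounded up when it is not an integer. *)
Definition competitive (R : realType) (C : instance -> Prop)
    (A : forall (k : nat) (I : instance), schedule R I k) (c : R) : Prop :=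
  forall (I : instance) (m : nat), C I -> min_machines R I m ->
    feasible (A `|Num.ceil (c * m%:R)|%N I).

(* Main.v *)
Require Import Defs.
From mathcomp Require Import all_boot all_order all_algebra.
From mathcomp Require Import all_classical all_reals all_analysis.
From mathcomp Require Import zify ring lra.
Import Order.TTheory GRing.Theory Num.Theory.
Local Open Scope ring_scope.

(* Let q = m / (1 - alpha), so that EDF has k >= q / (1 - alpha) machines, and
   suppose that job j0, with release date r and deadline d, is late.  Let S be the
   set of jobs of priority at least that of j0, and let W(t) and W*(t) be the
   total work of S left at time t by EDF and by an optimal schedule.  Then

     W(t) <= W*(t) + alpha q (d - t)   for t <= d,                           (1)

   by induction on t.  If EDF runs at least q jobs of S during [t - 1, t), this
   follows from the bound at t - 1, since the optimum runs at most
   m = q - alpha q of them.  Otherwise every available job of S runs during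
   [t - 1, t), and there are fewer than q of them.  If each has at most
   alpha (d - t) units left, (1) is immediate.  If some job j of S has more than
   that left, then by looseness it ran for less than alpha (t - r_j) units since
   its release date r_j; while it waited, all k machines ran jobs of S, so EDF
   did at least k (1 - alpha) (t - r_j) >= q (t - r_j) units of work of S during
   [r_j, t), and (1) follows from the bound at r_j.
   In the same way the late job j0 gives W(r) > q (d - r), whereas (1) gives
   W(r) <= m (d - r) + alpha q (d - r) = q (d - r). *)

Set Implicit Arguments.
Unset Strict Implicit.
Unset Printing Implicit Defensive.

(** * The priority order of EDF *)

Lemma edf_le_trans (I : instance) : transitive (@edf_le I).
Proof. move=> y x z; rewrite /edf_le; lia. Qed.

Lemma edf_le_total (I : instance) : total (@edf_le I).
Proof. move=> x y; rewrite /edf_le; lia. Qed.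

Lemma edf_le_refl (I : instance) : reflexive (@edf_le I).
Proof. move=> x; rewrite /edf_le; lia. Qed.

Lemma edf_le_deadline (I : instance) (j j' : job I) :
  edf_le j j' -> deadline j <= deadline j'.
Proof. rewrite /edf_le; lia. Qed.

(** * Jobs selected in one unit of time *)

Section Select.
Context (I : instance) (k : nat) (rem : job I -> nat) (t : int).

Lemma edf_select_uniq : uniq (edf_select k rem t).
Proof. by rewrite take_uniq// sort_uniq filter_uniq// enum_uniq. Qed.

Lemma size_edf_select : (size (edf_select k rem t) <= k)%N.
Proof. by rewrite size_take_min geq_minl. Qed.

Lemma mem_edf_select j :
  j \in edf_select k rem t -> (release j <= t) && (0 < rem j)%N.
Proof. by move=> /mem_take; rewrite mem_sort mem_filter => /andP[]. Qed.

(** A waiting job lies in the part of the sorted list cut off by [take k], so the kept part has full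
    length and precedes it. *)
Lemma edf_select_full j : release j <= t -> (0 < rem j)%N ->
  j \notin edf_select k rem t ->
  size (edf_select k rem t) = k /\
  {in edf_select k rem t, forall j', edf_le j' j}.
Proof.
move=> rj remj; rewrite /edf_select; set s := sort _ _ => jN.
have js : j \in s by rewrite mem_sort mem_filter rj remj mem_enum.
have jd : j \in drop k s.
  by move: js; rewrite -{1}(cat_take_drop k s) mem_cat (negbTE jN).
have ks : (k < size s)%N.
  by case: ltnP => // /drop_oversize ds; rewrite ds in jd.
have : sorted (@edf_le I) s by apply/sort_sorted/edf_le_total.
rewrite (sorted_pairwise (@edf_le_trans I)) -{1}(cat_take_drop k s) pairwise_cat.
move=> /andP[/allrelP st _]; split; first by rewrite size_takel// ltnW.
by move=> j' j't; exact: st.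
Qed.
End Select.

(* Slot [n] is the unit of time [[edf_origin I + n, edf_origin I + n + 1)]. *)
Definition release_slot (I : instance) (j : job I) : nat :=
  `|release j - edf_origin I|%N.

(* Meaningless for a deadline before [edf_origin I], which looseness excludes. *)
Definition deadline_slot (I : instance) (j : job I) : nat :=
  `|deadline j - edf_origin I|%N.

Lemma edf_origin_le (I : instance) (j : job I) : edf_origin I <= release j.
Proof. by rewrite /edf_origin (bigminD1 j)//= ge_min lexx. Qed.

Lemma release_slotE (I : instance) (j : job I) :
  release j = edf_origin I + (release_slot j)%:Z.
Proof. have := edf_origin_le j; rewrite /release_slot; lia. Qed.

(** * Work done by EDF, counted in unit slots *)

Section Counting.
Context (I : instance) (k : nat).

Definition edf_slot (n : nat) : seq (job I) :=
  edf_select k (edf_remaining k n) (edf_origin I + n%:Z).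

Local Notation rem := (edf_remaining k).

Lemma mem_edf_slot n j :
  j \in edf_slot n -> (release_slot j <= n)%N && (0 < rem n j)%N.
Proof.
move=> /mem_edf_select/andP[rj ->]; rewrite andbT.
by move: rj; rewrite release_slotE lerD2l lez_nat.
Qed.

(** The truncated subtraction in [edf_remaining] is exact, because only jobs with work left are
    selected. *)
Lemma edf_remaining_sum n n' j : (n' <= n)%N ->
  (rem n j + \sum_(n' <= i < n) (j \in edf_slot i))%N = rem n' j.
Proof.
elim: n => [|n IH]; first by rewrite leqn0 => /eqP->; rewrite big_geq// addn0.
rewrite leq_eqVlt => /predU1P[->|]; first by rewrite big_geq// addn0.
rewrite ltnS => n'n; rewrite big_nat_recr//= -IH// /edf_slot.
have := @mem_edf_slot n j; rewrite /edf_slot.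
case: (j \in _) => [/(_ isT)/andP[_ rem_gt0]|_]; last by rewrite subn0 addn0.
by rewrite /= subn1 addn1 addnS -addSn prednK.
Qed.

Lemma edf_remaining_le n n' (j : job I) : (n' <= n)%N -> (rem n j <= rem n' j)%N.
Proof. by move=> /edf_remaining_sum <-; rewrite leq_addr. Qed.

Lemma edf_remaining_unreleased n (j : job I) :
  (n <= release_slot j)%N -> rem n j = proc j.
Proof.
move=> nr; have <- : rem 0%N j = proc j by [].
rewrite -(@edf_remaining_sum n 0%N)// big_nat_cond big1 ?addn0// => i.
rewrite andbT => /andP[_ ilt]; case: (boolP (j \in _)) => // /mem_edf_slot/andP[rj _].
by move: (leq_trans nr rj); rewrite leqNgt ilt.
Qed.

Section Priority.
Context (j0 : job I).

(** W of the proof idea, S being the jobs [j] with [edf_le j j0]. *)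
Definition edf_workload n : nat := (\sum_(j | edf_le j j0) rem n j)%N.
Definition edf_load n : nat := (\sum_(j | edf_le j j0) (j \in edf_slot n))%N.

Lemma edf_workload_sum n n' : (n' <= n)%N ->
  (edf_workload n + \sum_(n' <= i < n) edf_load i)%N = edf_workload n'.
Proof.
move=> n'n; rewrite exchange_big/= -big_split/=.
by apply: eq_bigr => j _; exact: edf_remaining_sum.
Qed.

Lemma edf_load_full n j : edf_le j j0 -> (release_slot j <= n)%N ->
  (0 < rem n j)%N -> j \notin edf_slot n -> edf_load n = k.
Proof.
move=> jj0 rj remj jN.
have [|sz le_j] := @edf_select_full I k _ _ j _ remj jN.
  by rewrite release_slotE lerD2l lez_nat.
rewrite /edf_load -big_mkcondr/= sum1dep_card.
rewrite -[RHS]sz -(card_uniqP (edf_select_uniq _ _ _)); apply: eq_card => j'.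
rewrite !inE; apply/andP/idP => [[]//|j's]; split=> //.
by apply: (@edf_le_trans _ j); first exact: le_j.
Qed.

(* Whenever the unfinished job [j] waits, all [k] machines run jobs of priority
   at least that of [j]. *)
Lemma edf_load_sum_ge n j : edf_le j j0 -> (release_slot j <= n)%N ->
  (0 < rem n j)%N ->
  (k * (n - release_slot j) + k * rem n j <=
   \sum_(release_slot j <= i < n) edf_load i + k * proc j)%N.
Proof.
move=> jj0 rn remj.
rewrite -(@edf_remaining_unreleased (release_slot j) j)//.
rewrite -(@edf_remaining_sum n (release_slot j))// mulnDr addnCA addnC leq_add2l.
rewrite mulnC -sum_nat_const_nat big_distrr/= -big_split/=.
rewrite big_nat_cond [leqRHS]big_nat_cond; apply: leq_sum => i.
rewrite andbT => /andP[ri ilt].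
(* In each slot either [j] runs, which contributes [k] on the right, or it waits and the load is
   [k]. *)
have [|jN] := boolP (j \in _); first by rewrite muln1 leq_addl.
rewrite muln0 addn0 (@edf_load_full i j)//.
by rewrite (leq_trans remj)// edf_remaining_le// ltnW.
Qed.

End Priority.
End Counting.

(** * Looseness in terms of slots *)

Section Loose.
Context (R : realType) (I : instance) (alpha : R).
Hypotheses (alpha_gt0 : 0 < alpha) (loose_alpha : loose alpha I).

Lemma loose_release_le_deadline (j : job I) : release j <= deadline j.
Proof.
rewrite -subr_ge0 -(ler0z R) -(pmulr_rge0 _ alpha_gt0).
exact: le_trans (loose_alpha j).
Qed.

Lemma deadline_slotE (j : job I) :
  deadline j = edf_origin I + (deadline_slot j)%:Z.
Proof.
have := loose_release_le_deadline j; have := edf_origin_le j.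
rewrite /deadline_slot; lia.
Qed.

Lemma release_slot_le_deadline (j : job I) :
  (release_slot j <= deadline_slot j)%N.
Proof.
have := loose_release_le_deadline j.
by rewrite release_slotE deadline_slotE lerD2l lez_nat.
Qed.

Lemma edf_le_deadline_slot (j j' : job I) :
  edf_le j j' -> (deadline_slot j <= deadline_slot j')%N.
Proof. by move=> /edf_le_deadline; rewrite !deadline_slotE lerD2l lez_nat. Qed.

Lemma loose_slot (j : job I) :
  (proc j)%:R <= alpha * ((deadline_slot j)%:R - (release_slot j)%:R).
Proof.
have := loose_alpha j; rewrite release_slotE deadline_slotE.
by rewrite opprD addrACA subrr add0r rmorphB/= !pmulrn.
Qed.

(** * The invariant comparing EDF with an optimal schedule *)

Section Backlog.
Context (k m : nat) (j0 : job I) (o : job I -> nat -> R).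
Hypotheses (alpha_lt1 : alpha < 1) (le_mk : m%:R / (1 - alpha) ^+ 2 <= k%:R :> R).
(* [o j n] stands for the amount of job [j] that an optimal schedule has
   processed before slot [n]. *)
Hypotheses
  (o_start : forall j n, (n <= release_slot j)%N -> o j n = 0)
  (o_le : forall j n, o j n <= (proc j)%:R)
  (o_rate : forall n' n, (n' <= n)%N ->
     \sum_(j | edf_le j j0) (o j n - o j n') <= m%:R * (n%:R - n'%:R)).

Let q : R := m%:R / (1 - alpha).
Let d : nat := deadline_slot j0.

Let alpha_neq1 : 1 - alpha != 0.
Proof. by rewrite subr_eq0 eq_sym lt_eqF. Qed.

Let q_split : q = m%:R + alpha * q.
Proof. rewrite /q; by field. Qed.

Let q_ge0 : 0 <= q.
Proof. by rewrite divr_ge0// subr_ge0 ltW. Qed.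

Let aq_ge0 : 0 <= alpha * q.
Proof. exact: mulr_ge0 (ltW alpha_gt0) q_ge0. Qed.

Let q_le : q <= (1 - alpha) * k%:R.
Proof.
have -> : q = (1 - alpha) * (m%:R / (1 - alpha) ^+ 2) by rewrite /q; by field.
by rewrite ler_wpM2l// subr_ge0 ltW.
Qed.

Let q_le_k : q <= k%:R.
Proof. by apply: (le_trans q_le); rewrite ler_piMl//; move: alpha_gt0; lra. Qed.

(** The invariant W <= W* + alpha q (d - t) at the start of slot [n]; the sum is W*. *)
Definition backlog_bound n : Prop :=
  (edf_workload k j0 n)%:R <=
  \sum_(j | edf_le j j0) ((proc j)%:R - o j n) + alpha * q * (d%:R - n%:R).

(** Over the slots from [n'] to [n], W falls by at least q per slot on average and W* by at most m;
    q - m = alpha q is the rate at which the slack term shrinks. *)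
Lemma backlog_bound_step n' n : (n' <= n)%N ->
  q * (n%:R - n'%:R) <= (\sum_(n' <= i < n) edf_load k j0 i)%:R ->
  backlog_bound n' -> backlog_bound n.
Proof.
move=> n'n load_ge; rewrite /backlog_bound.
rewrite -(edf_workload_sum k j0 n'n) natrD => bn'.
have -> : \sum_(j | edf_le j j0) ((proc j)%:R - o j n) =
    \sum_(j | edf_le j j0) ((proc j)%:R - o j n') -
    \sum_(j | edf_le j j0) (o j n - o j n').
  by rewrite -sumrB; apply: eq_bigr => j _; ring.
have := o_rate n'n.
have : q * (n%:R - n'%:R) = (m%:R + alpha * q) * (n%:R - n'%:R) by rewrite -q_split.
lra.
Qed.

(** The bound on [proc j] says that [j] ran in at most alpha (n - r_j) slots since its release. In
    the others all k machines are busy with S, and k (1 - alpha) >= q. *)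
Lemma edf_load_ge_waiting n j : edf_le j j0 ->
  (release_slot j <= n)%N -> (0 < edf_remaining k n j)%N ->
  (proc j)%:R <= alpha * (n%:R - (release_slot j)%:R) + (edf_remaining k n j)%:R ->
  q * (n%:R - (release_slot j)%:R) <=
    (\sum_(release_slot j <= i < n) edf_load k j0 i)%:R.
Proof.
move=> jj0 rn remj pj.
have := edf_load_sum_ge jj0 rn remj.
rewrite -(ler_nat R) !natrD !natrM natrB// => load_ge.
have nr_ge0 : 0 <= n%:R - (release_slot j)%:R :> R by rewrite subr_ge0 ler_nat.
have := ler_wpM2r nr_ge0 q_le.
have := ler_wpM2l (ler0n R k) pj.
lra.
Qed.

Lemma edf_backlog n : (n <= d)%N -> backlog_bound n.
Proof.
(* Strong induction, since one case goes back to a release slot. *)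
elim/ltn_ind: n => -[_ _|n IH nd].
  rewrite /backlog_bound subr0 /edf_workload natr_sum.
  rewrite -[leLHS]addr0 lerD//; last exact: mulr_ge0.
  by apply: ler_sum => j _; rewrite o_start// subr0.
have dn_ge0 : 0 <= d%:R - n.+1%:R :> R by rewrite subr_ge0 ler_nat.
have [q_load|load_q] := leP q (edf_load k j0 n)%:R.
  apply: (@backlog_bound_step n) => //; last by apply: IH => //; exact: ltnW.
  by rewrite big_nat1 -natrB// subSnn mulr1.
have [late|] := pselect (exists j, [/\ edf_le j j0, (release_slot j <= n)%N &
    alpha * (d%:R - n.+1%:R) < (edf_remaining k n.+1 j)%:R]).
  have [j [jj0 rn remj]] := late.
  apply: (@backlog_bound_step (release_slot j)); first exact: leqW.
  - apply: edf_load_ge_waiting => //; first exact: leqW.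
      rewrite -(ltr_nat R); apply: le_lt_trans remj.
      exact: mulr_ge0 (ltW alpha_gt0) dn_ge0.
    (* p_j <= alpha (d_j - r_j) <= alpha (d - r_j), and d - r_j is split at n + 1. *)
    have := loose_slot j.
    have : alpha * (deadline_slot j)%:R <= alpha * d%:R.
      by rewrite ler_wpM2l ?ler_nat ?ltW// edf_le_deadline_slot.
    lra.
  - by apply: IH => //; exact: leq_trans (leqW rn) nd.
move=> /forallNP not_late; rewrite /backlog_bound.
(* Each job of S running in slot [n] is charged alpha (d - n - 1), and there are fewer than q of
   them. Any other job of S is finished or unreleased: an available one left waiting would force the
   load to be k >= q. *)
have : (edf_workload k j0 n.+1)%:R <=
    \sum_(j | edf_le j j0) ((proc j)%:R - o j n.+1 +
      (j \in edf_slot I k n)%:R * (alpha * (d%:R - n.+1%:R))).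
  rewrite /edf_workload natr_sum; apply: ler_sum => j jj0.
  have [rn|nr] := leqP (release_slot j) n; last first.
    rewrite edf_remaining_unreleased// o_start// subr0 lerDl.
    by apply: mulr_ge0 => //; exact: mulr_ge0 (ltW alpha_gt0) dn_ge0.
  have remj : (edf_remaining k n.+1 j)%:R <= alpha * (d%:R - n.+1%:R).
    by rewrite leNgt; apply/negP => remj; exact: (not_late j).
  have po := o_le j n.+1.
  have [|jN] := boolP (j \in _); first by rewrite mul1r; lra.
  have [rem0|rem_gt0] := posnP (edf_remaining k n.+1 j); first by rewrite rem0 mul0r; lra.
  have : (0 < edf_remaining k n j)%N.
    by apply: leq_trans rem_gt0 _; exact: edf_remaining_le.
  move=> /(edf_load_full jj0 rn)/(_ jN) loadk.
  by move: load_q; rewrite loadk ltNge q_le_k.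
move=> /le_trans; apply; rewrite big_split/= lerD2l -mulr_suml -natr_sum [alpha * q]mulrC -mulrA.
by apply: ler_wpM2r; [exact: mulr_ge0 (ltW alpha_gt0) dn_ge0 | exact: ltW].
Qed.

Lemma edf_meets_deadline :
  (forall j n, (deadline_slot j <= n)%N -> o j n = (proc j)%:R) ->
  edf_remaining k d j0 = 0%N.
Proof.
move=> o_end; apply/eqP; rewrite -leqn0 leqNgt; apply/negP => remd.
have rd := release_slot_le_deadline j0.
have load_ge := edf_load_ge_waiting (edf_le_refl j0) rd remd.
have /load_ge{}load_ge : (proc j0)%:R <=
    alpha * (d%:R - (release_slot j0)%:R) + (edf_remaining k d j0)%:R.
  by apply: (le_trans (loose_slot j0)); rewrite lerDl.
have := edf_backlog rd; rewrite /backlog_bound.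
rewrite -(edf_workload_sum k j0 rd) natrD.
(* The work that [j0] still lacks at [d] makes the final inequality strict. *)
have : 1 <= (edf_workload k j0 d)%:R :> R.
  rewrite ler1n /edf_workload (bigD1 j0) ?edf_le_refl//=.
  exact: leq_trans remd (leq_addr _ _).
(* Every job of S is due by [d], so W* at the release of [j0] is what the optimum processes from
   then to [d]. *)
have -> : \sum_(j | edf_le j j0) ((proc j)%:R - o j (release_slot j0)) =
    \sum_(j | edf_le j j0) (o j d - o j (release_slot j0)).
  by apply: eq_bigr => j jj0; rewrite (o_end _ d)// edf_le_deadline_slot.
have := o_rate rd.
have : q * (d%:R - (release_slot j0)%:R) =
    (m%:R + alpha * q) * (d%:R - (release_slot j0)%:R) by rewrite -q_split.
lra.
Qed.

End Backlog.
End Loose.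

(** * Work processed by a feasible schedule up to a given time *)

Section ProcessedBy.
Local Open Scope classical_set_scope.
Context (R : realType) (I : instance) (m : nat) (s : schedule R I m).
Hypothesis feasible_s : feasible s.

Local Notation mu := (@lebesgue_measure R).

(* The closed ray [`]-oo, x]] rather than the half-open one: a feasible schedule
   may run a job at the very instant of its deadline, and the release date itself
   is a null set. *)
Definition processed_by (j : job I) (x : R) : R :=
  \sum_(i < m) fine (mu (processing_times s i j `&` `]-oo, x])).

Let measurable_run i j : measurable (processing_times s i j).
Proof. by case: feasible_s. Qed.

Let measurable_runI i j (A : interval R) :
  measurable (processing_times s i j `&` [set` A]).
Proof. exact: measurableI. Qed.

Let run_fin (A : set R) i j : measurable A ->
  mu (processing_times s i j `&` A) \is a fin_num.
Proof.
move=> mA; rewrite ge0_fin_numE//.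
case: feasible_s => _ _ _ /(_ j) sum_eq.
apply: (@le_lt_trans _ _ (proc j)%:R%:E); last exact: ltry.
rewrite -sum_eq (bigD1 i)//= -[leLHS]adde0; apply: leeD; last exact: sume_ge0.
by apply: measureIl => //; exact: measurable_run.
Qed.

Lemma processed_by_release j x : x <= (release j)%:~R -> processed_by j x = 0.
Proof.
move=> xr; rewrite /processed_by big1// => i _.
suff -> : mu (processing_times s i j `&` `]-oo, x]) = 0%E by [].
apply: (@subset_measure0 _ _ _ mu _ [set x]) => //.
- exact: measurable_runI.
- move=> t [/=]; case: feasible_s => _ _ range _ /range/andP[rt _].
  by rewrite in_itv/= => tx; apply/le_anti; rewrite tx (le_trans xr).
- exact: lebesgue_measure_set1.
Qed.

Lemma processed_by_le j x : processed_by j x <= (proc j)%:R.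
Proof.
case: feasible_s => _ _ _ /(_ j) sum_eq.
rewrite -lee_fin -sum_eq -sumEFin; apply: lee_sum => i _.
rewrite fineK ?run_fin//.
by apply: measureIl => //; exact: measurable_run.
Qed.

Lemma processed_by_deadline j x :
  (deadline j)%:~R <= x -> processed_by j x = (proc j)%:R.
Proof.
move=> dx; case: feasible_s => _ _ range /(_ j) sum_eq.
apply: EFin_inj; rewrite -sum_eq -sumEFin; apply: eq_bigr => i _.
rewrite fineK ?run_fin//; congr (mu _); apply/setIidPl => t /= /range/andP[_ td].
by rewrite in_itv/= (le_trans td).
Qed.

(** On one machine the running times of different jobs within []x, y]] are disjoint, so their
    measures add up to at most y - x. *)
Lemma processed_by_rate (P : pred (job I)) (x y : R) : x <= y ->
  \sum_(j | P j) (processed_by j y - processed_by j x) <= m%:R * (y - x).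
Proof.
move=> xy.
have split i j : fine (mu (processing_times s i j `&` `]-oo, y])) -
    fine (mu (processing_times s i j `&` `]-oo, x])) =
    fine (mu (processing_times s i j `&` `]x, y])).
  have -> : processing_times s i j `&` `]-oo, y] =
      (processing_times s i j `&` `]-oo, x]) `|`
      (processing_times s i j `&` `]x, y]).
    rewrite -setIUr; congr (_ `&` _); apply/seteqP; split => t /=.
      by rewrite !in_itv/= => ->; rewrite andbT; case: leP; [left|right].
    by rewrite !in_itv/= => -[/le_trans|/andP[]]//; apply.
  rewrite measureU//.
  - by rewrite fineD ?run_fin// addrAC subrr add0r.
  - exact: measurable_runI.
  - exact: measurable_runI.
  - apply/seteqP; split => t //= [[_ +] [_ +]].
    by rewrite !in_itv/= => tx /andP[/lt_le_trans/(_ tx)]; rewrite ltxx.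
(* Increments are nonnegative, so the sum may be extended from [P] to all jobs. *)
apply: (@le_trans _ _ (\sum_j (processed_by j y - processed_by j x))).
  rewrite big_mkcond; apply: ler_sum => j _; case: ifP => // _.
  by rewrite /processed_by -sumrB sumr_ge0// => i _; rewrite split fine_ge0.
under eq_bigr do rewrite /processed_by -sumrB.
rewrite exchange_big/= -[m in m%:R]card_ord mulr_natl -sumr_const.
apply: ler_sum => i _; under eq_bigr do rewrite split.
rewrite -lee_fin -sumEFin.
under eq_bigr do rewrite fineK ?run_fin//.
rewrite -measure_semi_additive_ord//.
- have -> : (y - x)%:E = mu `]x, y].
    rewrite lebesgue_measure_itv/= lte_fin; case: ltgtP xy => // -> _.
    by rewrite subrr.
  apply: le_measure; rewrite ?inE//.
    by apply: bigsetU_measurable => j _; exact: measurable_runI.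
  apply: (big_ind (fun A => A `<=` `]x, y])) => [||j _].
  - exact: sub0set.
  - by move=> A B AX BX; rewrite subUset.
  - exact: subIsetr.
- by move=> j; exact: measurable_runI.
- by move=> j j' _ _ [t [[+ _] [+ _]]]; rewrite /processing_times/= => -> [].
- by apply: bigsetU_measurable => j _; exact: measurable_runI.
Qed.
End ProcessedBy.

(** * The EDF schedule in continuous time *)

Lemma sum_onth_uniq (T : eqType) (s : seq T) (k : nat) (x : T) :
  uniq s -> (size s <= k)%N -> (\sum_(i < k) (onth s i == Some x))%N = (x \in s).
Proof.
move=> uniq_s sk; have [xs|/onthP xNs] := boolP (x \in s).
  have /onthP[i six] := xs.
  have lt_is : (i < size s)%N by rewrite ltnNge; apply/negP => /onth_default; rewrite six.
  rewrite (bigD1 (Ordinal (leq_trans lt_is sk)))//= six eqxx big1 ?addn0// => i' i'N.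
  case: eqP => // si'x; case/eqP: i'N; apply/val_inj => /=.
  have min_lt : (minn i i' < size s)%N by rewrite gtn_min lt_is.
  exact: (onth_inj _ _ _ uniq_s min_lt (etrans si'x (esym six))).
by rewrite big1// => i _; case: eqP => // six; case: xNs; exists i.
Qed.

Section EdfFeasible.
Local Open Scope classical_set_scope.
Context (R : realType) (I : instance) (k : nat).

Local Notation mu := (@lebesgue_measure R).
Local Notation edf_schedule := (@edf R k I).

(** Half-open, so that the slots are fibres of [Num.floor]. *)
Definition slot_itv (n : nat) : set R :=
  `[(edf_origin I + n%:Z)%:~R, (edf_origin I + n%:Z + 1)%:~R[.

Lemma slot_itvE n t : slot_itv n t = (Num.floor t = edf_origin I + n%:Z).
Proof.
apply/propext; rewrite /slot_itv/= in_itv/=; split; first exact: floor_def.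
by move=> <-; exact: floor_itv.
Qed.

Lemma slot_itv_measure n : mu (slot_itv n) = 1%E.
Proof.
rewrite lebesgue_measure_itv/= lte_fin ltr_int ltrDl ltr01.
by rewrite -EFinB -rmorphB/= addrAC subrr add0r.
Qed.

Lemma edf_schedule_slot t n : Num.floor t = edf_origin I + n%:Z ->
  forall i, edf_schedule t i = onth (edf_slot I k n) i.
Proof. by move=> ft i; rewrite /edf ft /edf_jobs addrAC subrr add0r. Qed.

(** A running job is released, so [t] is not before [edf_origin I] and the absolute value in
    [edf_jobs] is harmless. *)
Lemma edf_schedule_floor t i j : edf_schedule t i = Some j ->
  exists n, [/\ Num.floor t = edf_origin I + n%:Z, j \in edf_slot I k n
    & onth (edf_slot I k n) i = Some j].
Proof.
move=> tij; have : j \in edf_jobs I k (Num.floor t) by apply/onthP; exists i.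
move=> /mem_edf_select/andP[rt _].
have ft : Num.floor t = edf_origin I + `|Num.floor t - edf_origin I|%N%:Z.
  by have := edf_origin_le j; lia.
have := tij; rewrite (edf_schedule_slot ft) => sij.
by exists `|Num.floor t - edf_origin I|%N; split => //; apply/onthP; exists i.
Qed.

Let run_slot (i : 'I_k) j n : set R :=
  if onth (edf_slot I k n) i == Some j then slot_itv n else set0.

Let measurable_run_slot i j n : measurable (run_slot i j n).
Proof. by rewrite /run_slot; case: ifP => _ //; exact: measurable_itv. Qed.

Let trivIset_run_slot i j : trivIset setT (run_slot i j).
Proof.
move=> n n' _ _ [t []]; rewrite /run_slot.
by case: ifP => // _; case: ifP => // _; rewrite !slot_itvE => -> /addrI[].
Qed.

Lemma edf_processing_times (i : 'I_k) (j : job I) (N : nat) :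
  (forall n, (N <= n)%N -> j \notin edf_slot I k n) ->
  processing_times edf_schedule i j = \big[setU/set0]_(n < N) run_slot i j n.
Proof.
move=> idle; rewrite -bigcup_mkord; apply/seteqP; split=> t /=.
  move=> /edf_schedule_floor[n [ft jn sij]]; exists n.
    by rewrite /= ltnNge; apply: contraL jn => /idle.
  by rewrite /run_slot sij eqxx slot_itvE.
move=> [n _]; rewrite /run_slot; case: eqP => // sij.
by rewrite slot_itvE /processing_times/= => /edf_schedule_slot ->.
Qed.

Context (alpha : R).
Hypotheses (alpha_gt0 : 0 < alpha) (loose_alpha : loose alpha I).

Lemma edf_feasible :
  (forall j : job I, edf_remaining k (deadline_slot j) j = 0%N) ->
  feasible edf_schedule.
Proof.
move=> met.
have idle j n : (deadline_slot j <= n)%N -> j \notin edf_slot I k n.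
  move=> dn; apply/negP => /mem_edf_slot/andP[_].
  by rewrite ltnNge -(met j) edf_remaining_le.
split.
- move=> i j; rewrite (edf_processing_times i (@idle j)).
  by apply: bigsetU_measurable => n _; exact: measurable_run_slot.
- move=> t i i' j /edf_schedule_floor[n [ft _ sij]].
  rewrite (edf_schedule_slot ft) => si'j; apply/val_inj.
  have min_lt : (minn i' i < size (edf_slot I k n))%N.
    rewrite gtn_min; apply/orP; right; rewrite ltnNge; apply/negP => /onth_default.
    by rewrite sij.
  exact: (onth_inj _ _ _ (edf_select_uniq _ _ _) min_lt (etrans sij (esym si'j))).
- move=> t i j /edf_schedule_floor[n [ft jn _]].
  have /andP[ft_le lt_tf] := floor_itv t.
  have [rn _] := andP (mem_edf_slot jn).
  (* The strict inequality makes the whole unit interval of slot [n] end by the deadline. *)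
  have nd : (n < deadline_slot j)%N by rewrite ltnNge; apply: contraL jn => /idle.
  apply/andP; split.
    by apply: le_trans ft_le; rewrite ler_int ft release_slotE lerD2l lez_nat.
  apply: (le_trans (ltW lt_tf)).
  rewrite ler_int ft (deadline_slotE alpha_gt0 loose_alpha).
  by rewrite -addrA lerD2l -PoszD addn1 lez_nat.
- move=> j.
  have run_time (i : 'I_k) : mu (processing_times edf_schedule i j) =
      (\sum_(n < deadline_slot j) (onth (edf_slot I k n) i == Some j)%:R)%:E.
    rewrite (edf_processing_times i (@idle j)) measure_bigsetU//; last first.
      by move=> n; exact: measurable_run_slot.
    rewrite -sumEFin; apply: eq_bigr => n _; rewrite /run_slot.
    by case: ifP => _; [exact: slot_itv_measure|exact: measure0].
  under eq_bigr do rewrite run_time.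
  (* In each slot a selected job occupies exactly one machine, so the total counts the slots in
     which [j] runs. *)
  rewrite sumEFin exchange_big/=.
  under eq_bigr do rewrite -natr_sum sum_onth_uniq ?edf_select_uniq
    ?size_edf_select//.
  rewrite -natr_sum; congr (_%:R%:E).
  have := edf_remaining_sum k j (leq0n (deadline_slot j)).
  by rewrite met add0n big_mkord.
Qed.

End EdfFeasible.

(** * Competitiveness of EDF *)

Theorem theorem2 (R : realType) (alpha : R)
    (alpha_gt0 : 0 < alpha) (alpha_lt1 : alpha < 1) :
  competitive (loose alpha) (@edf R) (1 / (1 - alpha) ^+ 2).
Proof.
move=> I m loose_alpha [[s feasible_s] _].
set k := `|_|%N.
have le_mk : m%:R / (1 - alpha) ^+ 2 <= k%:R :> R.
  set c : R := 1 / _ * _ in k *.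
  have -> : m%:R / (1 - alpha) ^+ 2 = c by rewrite /c mul1r mulrC.
  apply: (le_trans (ceil_ge c)).
  (* Removes the absolute value around the ceiling; [ceil_ge0] asks only for -1 < c. *)
  have c_ge0 : 0 <= Num.ceil c.
    by rewrite ceil_ge0 (lt_le_trans (ltrN10 _))// mulr_ge0// divr_ge0 ?sqr_ge0.
  by rewrite -[k%:R]/((k%:Z)%:~R) /k gez0_abs.
apply: (edf_feasible alpha_gt0 loose_alpha) => j0.
(* The optimum may preempt at any real time; it is sampled at slot boundaries. *)
pose o j n := processed_by s j ((edf_origin I + n%:Z)%:~R : R).
apply: (edf_meets_deadline alpha_gt0 loose_alpha alpha_lt1 le_mk (o := o)).
- move=> j n nr; apply: processed_by_release => //.
  by rewrite ler_int release_slotE lerD2l lez_nat.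
- by move=> j n; exact: processed_by_le.
- move=> n' n n'n; have := processed_by_rate feasible_s (fun j => edf_le j j0).
  move=> /(_ (edf_origin I + n'%:Z)%:~R (edf_origin I + n%:Z)%:~R).
  rewrite ler_int lerD2l lez_nat => /(_ n'n).
  by rewrite -rmorphB/= opprD addrACA subrr add0r rmorphB.
- move=> j n dn; apply: processed_by_deadline => //.
  by rewrite ler_int (deadline_slotE alpha_gt0 loose_alpha) lerD2l lez_nat.
Qed.
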